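(* Let $N\ge1$ be an integer, $A>-1/2$, $B\in(-A,A+1)$, and let $C$ be real with either $C<-A-N+1$ or $C>A+N$. Let $\mathcal T=(-(A+B),\infty)$ if $C<-A-N+1$, and $\mathcal T=(-(A+B),C-A-N)$ if $C>A+N$. For $s<t$ in $\mathcal T$ and $k,n\in\{0,\dots,N\}$ put $$p_{s,t}(k,n)=p_{n-k,N-k}\left(A+\tfrac t2+k,\,-A-s+\tfrac t2-k,\,C-\tfrac t2\right)\quad\text{if }k\le n,$$ and $p_{s,t}(k,n)=0$ if $n<k$. Then for all $s<t<u$ in $\mathcal T$: $p_{s,t}(k,n)\ge0$ for all $k,n\in\{0,\dots,N\}$; for all $0\le j\le n\le N$, $$p_{s,u}(j,n)=\sum_{k=j}^n p_{s,t}(j,k)\,p_{t,u}(k,n);$$ and for all $0\le j\le N$, $\sum_{k=j}^N p_{s,t}(j,k)=1$.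
   Context: Pochhammer symbol: $(\alpha)_0=1$, $(\alpha)_k=\alpha(\alpha+1)\cdots(\alpha+k-1)$. For integers $0\le k\le N$, $$p_{k,N}(a,b,c)=C_N(a,b,c)\,\frac{(2a)_k(a+1)_k(a+b)_k(a+c)_k(-N)_k}{k!\,(a)_k(a-b+1)_k(a-c+1)_k(2a+N+1)_k},\qquad C_N(a,b,c)=\frac{(a-b+1)_N(a-c+1)_N}{(2a+1)_N(-b-c+1)_N},$$ where the factor $(2a)_k(a+1)_k/(a)_k$ is read in its simplified form: $1$ if $k=0$, and $2(2a+1)_{k-1}(a+k)$ if $k\ge1$ (so that $a=0$ is allowed). *)

(* Defs.v *)
From mathcomp Require Import all_boot all_order all_algebra.
From mathcomp Require Import reals.

Set Implicit Arguments.
Unset Strict Implicit.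
Unset Printing Implicit Defensive.

Import Order.TTheory GRing.Theory Num.Theory.

Local Open Scope ring_scope.

Definition pochhammer (R : realType) (x : R) (k : nat) : R :=
  \prod_(i < k) (x + i%:R).

(* The quotient (2a)_k (a+1)_k / (a)_k after cancelling (a)_k: for k >= 1,
   (2a)_k = 2a (2a+1)_{k-1} and (a+1)_k / (a)_k = (a+k) / a, so it is given a
   value at a = 0 too. *)
Definition poch_ratio (R : realType) (a : R) (k : nat) : R :=
  if k is k'.+1 then 2 * pochhammer (2 * a + 1) k' * (a + k%:R) else 1.

Definition norm_const (R : realType) (N : nat) (a b c : R) : R :=
  (pochhammer (a - b + 1) N * pochhammer (a - c + 1) N) /
  (pochhammer (2 * a + 1) N * pochhammer (- b - c + 1) N).

(* Meaningful for k <= N; for k > N the factor (-N)_k makes it 0. *)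
Definition p_weight (R : realType) (k N : nat) (a b c : R) : R :=
  norm_const N a b c *
  ((poch_ratio a k * pochhammer (a + b) k * pochhammer (a + c) k *
    pochhammer (- N%:R) k) /
   (k`!%:R * pochhammer (a - b + 1) k * pochhammer (a - c + 1) k *
    pochhammer (2 * a + N%:R + 1) k)).

(* Only used when C < -A-N+1 or C > A+N; these two conditions are mutually
   exclusive as soon as A > -1/2 and N >= 1. *)
Definition time_set (R : realType) (N : nat) (A B C : R) : interval R :=
  if C < - A - N%:R + 1 then `](- (A + B)), +oo[
  else `](- (A + B)), (C - A - N%:R)[.

Definition trans_prob (R : realType) (N : nat) (A C : R) (s t : R)
    (k n : nat) : R :=
  if (k <= n)%N then
    p_weight (n - k) (N - k)
      (A + t / 2 + k%:R) (- A - s + t / 2 - k%:R) (C - t / 2)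
  else 0.

(* Main.v *)
Require Import Defs.
From mathcomp Require Import all_boot all_order all_algebra.
From mathcomp Require Import reals.
From mathcomp Require Import ring lra zify.

Set Implicit Arguments.
Unset Strict Implicit.
Unset Printing Implicit Defensive.

Import Order.TTheory GRing.Theory Num.Theory.

Local Open Scope ring_scope.

(** The transition probabilities are the summands of a terminating
    very-well-poised 5F4 series at 1, and everything follows from the classical
    evaluation of that series ([dougall_sum]).

    With [x = 2a], [y = a + b], [z = a + c] the weight [p_{k,N}(a,b,c)] becomes
    [dougall_term x y z k (N - k)].  The normalisation
    [sum_k p_{k,N}(a,b,c) = 1] is proved by the Wilf-Zeilberger method: going
    from [N] to [N + 1] changes the [k]-th summand by the difference of two
    consecutive values of an explicit certificate, so the sum does not depend
    on [N].

    The Chapman-Kolmogorov equation needs no other summation.  The bridge of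
    the chain, that is, the law of the state [k] at time [t] when the state is
    [j] at time [s] and [n] at time [u], belongs to the same family:
    [p^{N,C}_{s,t}(j,k) p^{N,C}_{t,u}(k,n)
       = p^{N,C}_{s,u}(j,n) p^{n,A+u+n}_{s,t}(j,k)],
    where [N] has been replaced by [n] and [C] by [A + u + n]
    ([trans_prob_chain]).  This is an identity between products of Pochhammer
    symbols; summing it over [k] and applying the normalisation to the last
    factor gives the equation.

    Nonnegativity is a count of signs: on the time set the factors
    [A + C + i] have one constant sign, and all the factors [A - C + t + 1 + i]
    and [A - C + s + 1 + i] have the opposite one ([trans_prob_ge0]). *)

(** * Pochhammer symbols *)

Lemma poch0 (R : realType) (x : R) : pochhammer x 0 = 1.
Proof. by rewrite /pochhammer big_ord0. Qed.

Lemma pochS (R : realType) (x : R) n :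
  pochhammer x n.+1 = pochhammer x n * (x + n%:R).
Proof. by rewrite /pochhammer big_ord_recr. Qed.

Lemma pochD (R : realType) (x : R) m n :
  pochhammer x (m + n) = pochhammer x m * pochhammer (x + m%:R) n.
Proof.
elim: n => [|n IHn]; first by rewrite addn0 poch0 mulr1.
by rewrite addnS !pochS IHn -mulrA natrD addrA.
Qed.

Lemma pochSl (R : realType) (x : R) n :
  pochhammer x n.+1 = x * pochhammer (x + 1) n.
Proof. by rewrite -add1n pochD pochS poch0 mul1r addr0. Qed.

Lemma poch_neq0 (R : realType) (x : R) n :
  (forall i, (i < n)%N -> x + i%:R != 0) -> pochhammer x n != 0.
Proof. by move=> x_nz; apply/prodf_neq0 => i _; exact: x_nz. Qed.

Lemma poch_gt0 (R : realType) (x : R) n :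
  (forall i, (i < n)%N -> 0 < x + i%:R) -> 0 < pochhammer x n.
Proof. by move=> x_gt0; apply: prodr_gt0 => i _; exact: x_gt0. Qed.

Lemma poch_opp (R : realType) (x : R) n :
  pochhammer (- x) n = (-1) ^+ n * pochhammer (x - n%:R + 1) n.
Proof.
elim: n => [|n IHn]; first by rewrite !poch0 expr0 mulr1.
rewrite pochS pochSl IHn exprS -natr1.
have -> : x - (n%:R + 1) + 1 + 1 = x - n%:R + 1 by ring.
by ring.
Qed.

Lemma poch_lt0_sign (R : realType) (x : R) n :
  (forall i, (i < n)%N -> x + i%:R < 0) -> 0 < (-1) ^+ n * pochhammer x n.
Proof.
elim: n => [|n IHn] x_lt0; first by rewrite poch0 mulr1 ltr01.
rewrite pochS exprS.
have -> : -1 * (-1) ^+ n * (pochhammer x n * (x + n%:R)) =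
          ((-1) ^+ n * pochhammer x n) * - (x + n%:R) by ring.
rewrite mulr_gt0 ?oppr_gt0 ?x_lt0 //.
by apply: IHn => i ltin; apply: x_lt0; exact: ltnW.
Qed.

Lemma fact_natr_neq0 (R : realType) (n : nat) : n`!%:R != 0 :> R.
Proof. by rewrite pnatr_eq0 -lt0n fact_gt0. Qed.

Lemma poch_fact (R : realType) k r :
  pochhammer (- (k + r)%:R) k = (-1) ^+ k * ((k + r)`!%:R / r`!%:R) :> R.
Proof.
have fact_nz := @fact_natr_neq0 R.
rewrite poch_opp natrD (addrC k%:R) addrK; congr (_ * _).
elim: k => [|k IHk]; first by rewrite poch0 add0n divff.
by rewrite pochS IHk addSn factS natrM -natr1 natrD; field.
Qed.

(** * The summand of the very-well-poised 5F4 series *)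

(** The quotient [(x+1)_{k-1} (x + 2k) / (x+1)_k], extended by [1] at [k = 0] so
    that [x = 0] is allowed. *)
Definition vwp_factor (R : realType) (x : R) k : R :=
  if k is 0 then 1 else (x + (2 * k)%:R) / (x + k%:R).

Lemma vwp_factorE (R : realType) (x : R) k :
  x + k%:R != 0 -> vwp_factor x k = (x + (2 * k)%:R) / (x + k%:R).
Proof. by case: k => // x_nz; rewrite muln0 divff. Qed.

(** The [k]-th normalised summand of the 5F4 series with [N = k + r].  The
    factors [(x-y+1)_k] and [(x-z+1)_k] of its denominator are cancelled against
    the normalising constant, and [(x+1)_N (x+N+1)_k] against [(x+1)_k], so
    that only [x] and [x - y - z] occur in the denominator. *)
Definition dougall_term (R : realType) (x y z : R) k r : R :=
  (-1) ^+ k * ((k + r)`!%:R / (k`!%:R * r`!%:R)) * vwp_factor x k *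
  (pochhammer y k * pochhammer z k *
   pochhammer (x - y + 1 + k%:R) r * pochhammer (x - z + 1 + k%:R) r) /
  (pochhammer (x + 1 + k%:R) (k + r) * pochhammer (x - y - z + 1) (k + r)).

(** The Wilf-Zeilberger certificate: with [N = k + r], the value of the telescoping
    antidifference at [k + 1].  Indexing by the successor avoids the factor
    [N + 1 - k] in the denominator, which would vanish at the last step. *)
Definition dougall_certificate (R : realType) (x y z : R) k r : R :=
  (-1) ^+ k * ((k + r)`!%:R / (k`!%:R * r`!%:R)) *
  (pochhammer y k.+1 * pochhammer z k.+1 *
   pochhammer (x - y + 1 + k%:R) r * pochhammer (x - z + 1 + k%:R) r) /
  (pochhammer (x + 1 + k%:R) (k + r).+1 * pochhammer (x - y - z + 1) (k + r).+1).

Lemma dougall_step0 (R : realType) (x y z : R) r :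
  (forall i, x + 1 + i%:R != 0) ->
  (forall i, (i <= r)%N -> x - y - z + 1 + i%:R != 0) ->
  dougall_term x y z 0 r.+1 - dougall_term x y z 0 r =
  dougall_certificate x y z 0 r.
Proof.
move=> x_nz xyz_nz.
have fact_nz := @fact_natr_neq0 R.
have nx : pochhammer (x + 1) r != 0 by apply: poch_neq0.
have nxyz : pochhammer (x - y - z + 1) r != 0.
  by apply: poch_neq0 => i /ltnW; exact: xyz_nz.
have h1 := x_nz r; have h2 := xyz_nz r (leqnn r).
rewrite /dougall_term /dougall_certificate /vwp_factor !add0n !addr0.
rewrite !pochS !poch0 fact0 addr0.
by field; rewrite nx nxyz h1 h2 !fact_nz.
Qed.

(** The Wilf-Zeilberger equation.  After division by the common factors it is
    the polynomial identity, where [k] stands for [k.+1] and [N] for [k.+1 + r],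
    [(x+2k)((N+1)yz + k(x+k)(x-y-z+N+1))
       = (N+1-k)(x+k)(y+k)(z+k) + k(x+k+N+1)(x-y+k)(x-z+k)]. *)
Lemma dougall_step (R : realType) (x y z : R) k r :
  (forall i, x + 1 + i%:R != 0) ->
  (forall i, (i <= k.+1 + r)%N -> x - y - z + 1 + i%:R != 0) ->
  dougall_term x y z k.+1 r.+1 - dougall_term x y z k.+1 r =
  dougall_certificate x y z k.+1 r - dougall_certificate x y z k r.+1.
Proof.
move=> x_nz xyz_nz.
have fact_nz := @fact_natr_neq0 R.
rewrite /dougall_term /dougall_certificate /vwp_factor.
have e1 (w : R) : w + 1 + k%:R + 1 = w + 1 + k.+1%:R by rewrite -natr1; ring.
rewrite !addSn !addnS.
set N := (k + r)%N.
rewrite !(pochSl (_ + 1 + k%:R)) !e1 !pochS !factS !natrM !exprS.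
have nP : pochhammer (x + 1 + k.+1%:R) N != 0.
  by apply: poch_neq0 => i _; rewrite -addrA -natrD.
have nQ : pochhammer (x - y - z + 1) N != 0.
  by apply: poch_neq0 => i iN; apply: xyz_nz; rewrite /N in iN; lia.
have h0 := x_nz k.
have h1 : x + 1 + k.+1%:R + N%:R != 0 by rewrite -addrA -natrD.
have h2 : x + 1 + k.+1%:R + N.+1%:R != 0 by rewrite -addrA -natrD.
have h3 : x - y - z + 1 + N%:R != 0 by apply: xyz_nz; rewrite /N; lia.
have h4 : x - y - z + 1 + N.+1%:R != 0 by apply: xyz_nz; rewrite /N; lia.
have := fact_nz k; have := fact_nz r; have := fact_nz N.
have eN : N%:R = k%:R + r%:R :> R by rewrite natrD.
have k1 : k.+1%:R != 0 :> R by rewrite pnatr_eq0.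
have r1 : r.+1%:R != 0 :> R by rewrite pnatr_eq0.
move: nP nQ h0 h1 h2 h3 h4 k1 r1.
rewrite -!(natr1 k) -!(natr1 r) -!(natr1 N.+1) -!(natr1 N) !eN.
move: (pochhammer (x + 1 + _) N) (pochhammer (x - y - z + 1) N) => P Q.
move: (pochhammer (x - y + 1 + _) r) (pochhammer (x - z + 1 + _) r) => U V.
move: (pochhammer y k) (pochhammer z k) ((-1) ^+ k) => Y Z s.
move: (k`!%:R) (r`!%:R) (N`!%:R) => fk fr fN.
move: (k%:R) (r%:R) => K L.
move=> nP nQ h0 h1 h2 h3 h4 k1 r1 _ fr0 fk0.
field.
by rewrite h0 h1 h2 h3 h4 nP nQ k1 r1 fr0 fk0.
Qed.

(** The boundary of the telescoping: passing from [N = k] to [N + 1] adds one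
    more summand, which the last value of the certificate compensates. *)
Lemma dougall_step_last (R : realType) (x y z : R) k :
  (forall i, x + 1 + i%:R != 0) ->
  (forall i, (i <= k)%N -> x - y - z + 1 + i%:R != 0) ->
  dougall_term x y z k.+1 0 + dougall_certificate x y z k 0 = 0.
Proof.
move=> x_nz xyz_nz.
have fact_nz := @fact_natr_neq0 R.
rewrite /dougall_term /dougall_certificate /vwp_factor !addn0.
have e1 (w : R) : w + 1 + k%:R + 1 = w + 1 + k.+1%:R by rewrite -natr1; ring.
rewrite (pochSl (x + 1 + k%:R)) e1 !(pochS (x + 1 + k.+1%:R)).
have := fact_nz k.+1; have := fact_nz k; rewrite !poch0 fact0 exprS.
have nQ : pochhammer (x - y - z + 1) k.+1 != 0 by apply: poch_neq0.
have nP : pochhammer (x + 1 + k.+1%:R) k != 0.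
  by apply: poch_neq0 => i _; rewrite -addrA -natrD.
have h0 := x_nz k.
have h1 : x + 1 + k.+1%:R + k%:R != 0 by rewrite -addrA -natrD.
rewrite natrM; move: nQ nP h0 h1; rewrite -!(natr1 k).
move: (pochhammer (x + 1 + _) k) (pochhammer (x - y - z + 1) k.+1) => P Q.
move: (k.+1`!%:R) (k`!%:R) => F1 F; move: (k%:R) => K.
move=> nQ nP h0 h1 f0 f1; field.
by rewrite nQ nP h0 h1 f0 f1.
Qed.

(** The terminating 5F4 summation, by induction on [N]: the increments telescope
    to a total of zero. *)
Lemma dougall_sum (R : realType) (x y z : R) N :
  (forall i, x + 1 + i%:R != 0) ->
  (forall i, (i < N)%N -> x - y - z + 1 + i%:R != 0) ->
  \sum_(0 <= k < N.+1) dougall_term x y z k (N - k) = 1.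
Proof.
move=> x_nz; elim: N => [|N IHN] xyz_nz.
  by rewrite big_nat1 /dougall_term /= !poch0 fact0 expr0 !(mulr1, divr1).
have sumN := IHN (fun i ltiN => xyz_nz i (ltnW ltiN)).
have telescope K : (K <= N)%N ->
  \sum_(0 <= k < K.+1) (dougall_term x y z k (N - k).+1 -
                        dougall_term x y z k (N - k)) =
  dougall_certificate x y z K (N - K).
  elim: K => [|K IHK] leKN.
    by rewrite big_nat1 subn0 dougall_step0.
  rewrite big_nat_recr //= IHK 1?ltnW // -(subnSK leKN) dougall_step //.
    by rewrite addrC subrK.
  by move=> i leiN; apply: xyz_nz; rewrite subnKC in leiN.
have /eqP := @dougall_step_last R x y z N x_nz xyz_nz.
rewrite addr_eq0 big_nat_recr //= subnn => /eqP ->.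
have := telescope N (leqnn N); rewrite subnn => <-.
rewrite sumrB sumN.
under eq_big_nat => k /andP[_ lekN] do rewrite subSn //.
ring.
Qed.

Lemma p_weightE (R : realType) (a b c : R) k r :
  (forall i, (i < k)%N -> a - b + 1 + i%:R != 0) ->
  (forall i, (i < k)%N -> a - c + 1 + i%:R != 0) ->
  (forall i, 2 * a + 1 + i%:R != 0) ->
  (forall i, (i < k + r)%N -> - b - c + 1 + i%:R != 0) ->
  p_weight k (k + r) a b c = dougall_term (2 * a) (a + b) (a + c) k r.
Proof.
move=> ab_nz ac_nz a_nz bc_nz.
have fact_nz := @fact_natr_neq0 R.
rewrite /p_weight /norm_const /dougall_term poch_fact.
have -> : 2 * a - (a + b) + 1 = a - b + 1 by ring.
have -> : 2 * a - (a + c) + 1 = a - c + 1 by ring.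
have -> : 2 * a - (a + b) - (a + c) + 1 = - b - c + 1 by ring.
have -> : 2 * a + (k + r)%:R + 1 = 2 * a + 1 + (k + r)%:R by ring.
rewrite !(pochD (a - b + 1)) !(pochD (a - c + 1)).
have nab : pochhammer (a - b + 1) k != 0 by exact: poch_neq0.
have nac : pochhammer (a - c + 1) k != 0 by exact: poch_neq0.
have nd : pochhammer (2 * a + 1 + k%:R) (k + r) != 0.
  by apply: poch_neq0 => i _; rewrite -addrA -natrD.
have n1 : pochhammer (2 * a + 1) (k + r) != 0 by exact: poch_neq0.
have n2 : pochhammer (2 * a + 1 + (k + r)%:R) k != 0.
  by apply: poch_neq0 => i _; rewrite -addrA -natrD.
(* Both sides carry the Pochhammer symbol (2a+1)_(2k+r), cut differently. *)
have key : poch_ratio a k / (pochhammer (2 * a + 1) (k + r) *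
               pochhammer (2 * a + 1 + (k + r)%:R) k) =
           vwp_factor (2 * a) k / pochhammer (2 * a + 1 + k%:R) (k + r).
  rewrite -pochD addnC pochD.
  case: k {ab_nz ac_nz bc_nz nab nac n1 n2} nd => [|k] nd; first by rewrite poch0 mul1r.
  have nk : pochhammer (2 * a + 1) k != 0 by exact: poch_neq0.
  have h : 2 * a + (k%:R + 1) != 0 by rewrite (addrC k%:R) addrA.
  rewrite /poch_ratio /vwp_factor pochS natrM -(natr1 k) in nd *.
  by field; rewrite nk nd h.
have nbc : pochhammer (- b - c + 1) (k + r) != 0 by exact: poch_neq0.
have fk := fact_nz k; have fr := fact_nz r.
have -> : poch_ratio a k = vwp_factor (2 * a) k / pochhammer (2 * a + 1 + k%:R) (k + r) *
            (pochhammer (2 * a + 1) (k + r) * pochhammer (2 * a + 1 + (k + r)%:R) k).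
  by rewrite -key divfK // mulf_neq0.
by field; rewrite nab nac nd n1 n2 nbc fk fr.
Qed.

(** * The bridge identity *)

(** Where the very-well-poised factor enters the bridge identity.  Up to the
    extension at [0], both sides are
    [(x + 2m + 2l) / (x + 2m + l)_{l+r+1}]. *)
Lemma vwp_factor_shift (R : realType) (x : R) m l r :
  (forall i, x + 1 + i%:R != 0) ->
  vwp_factor (x + (2 * m)%:R) l /
    pochhammer (x + (2 * m)%:R + 1 + l%:R) (l + r) =
  vwp_factor x (m + l) * pochhammer (x + (m + l)%:R) m /
    pochhammer (x + 1 + (m + l)%:R) (m + l + r).
Proof.
move=> x_nz; case: m => [|m]; first by rewrite muln0 addr0 !add0n poch0 mulr1.
have shift : x + 1 + (m.+1 + l)%:R + m%:R = x + 1 + (2 * m + l).+1%:R.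
  by rewrite -!natr1 !natrD; ring.
rewrite pochSl (_ : (m.+1 + l + r = m + (l + r).+1)%N); last by lia.
rewrite (pochD _ m) shift pochSl.
have -> : x + (m.+1 + l)%:R + 1 = x + 1 + (m.+1 + l)%:R by ring.
have -> : x + 1 + (2 * m + l).+1%:R + 1 = x + (2 * m.+1)%:R + 1 + l%:R.
  by rewrite mulnS -natr1 !natrD; ring.
have nP : pochhammer (x + 1 + (m.+1 + l)%:R) m != 0.
  by apply: poch_neq0 => i _; rewrite -addrA -natrD.
have nQ : pochhammer (x + (2 * m.+1)%:R + 1 + l%:R) (l + r) != 0.
  apply: poch_neq0 => i _.
  by rewrite (addrAC x) -!addrA -!natrD addrA.
have h0 : x + (m.+1 + l)%:R != 0.
  by have := x_nz (m + l)%N; rewrite -addrA nat1r -addSn.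
have e1 : x + 1 + (2 * m + l).+1%:R = x + (2 * m.+1)%:R + l%:R.
  by rewrite mulnS -natr1 !natrD; ring.
have h1 : x + (2 * m.+1)%:R + l%:R != 0 by rewrite -e1.
rewrite e1 !vwp_factorE //; move: nP nQ h0 h1.
rewrite !natrM !natrD -!(natr1 m) => nP nQ h0 h1.
by field; rewrite nP nQ h0 h1.
Qed.

(** The bridge identity in the parameters of the series.  The factors in [x - z]
    cancel because the numerator of the first term is the denominator of the
    second; the last term has [z] replaced by [x + y' + m + l], which makes
    [x - z + 1 + m] and [x - y - z + 1] equal to [1 - l - y'] and
    [1 - (m + l) - (y + y')], so that reflection produces [(y')_l] and
    [(y + y')_{m+l}]. *)
Lemma dougall_term_chain (R : realType) (x y y' z : R) m l r :
  (forall i, x + 1 + i%:R != 0) ->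
  (forall i, x + y' + 1 + i%:R != 0) ->
  (forall i, (i < l + r)%N -> x - z + 1 + (m + i)%:R != 0) ->
  (forall i, (i < m + l + r)%N -> x - y - z + 1 + i%:R != 0) ->
  (forall i, (i < m + l)%N -> y + y' + i%:R != 0) ->
  dougall_term x y z m (l + r) *
    dougall_term (x + y' + (2 * m)%:R) y' (z + m%:R) l r =
  dougall_term (x + y') (y + y') z (m + l) r *
    dougall_term x y (x + y' + (m + l)%:R) m l.
Proof.
move=> x_nz xy_nz xz_nz xyz_nz yy_nz.
have fact_nz := @fact_natr_neq0 R.
rewrite /dougall_term.
have -> : x + y' + (2 * m)%:R - y' - (z + m%:R) + 1 = x - z + 1 + m%:R.
  by rewrite natrM; ring.
have -> : x + y' + (2 * m)%:R - y' + 1 + l%:R = x + 1 + m%:R + (m + l)%:R.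
  by rewrite natrM natrD; ring.
have -> : x + y' + (2 * m)%:R - (z + m%:R) + 1 + l%:R = x + y' - z + 1 + (m + l)%:R.
  by rewrite natrM natrD; ring.
have -> : x + y' - (y + y') + 1 + (m + l)%:R = x - y + 1 + m%:R + l%:R.
  by rewrite natrD; ring.
have -> : x + y' - (y + y') - z + 1 = x - y - z + 1 by ring.
have -> : x - (x + y' + (m + l)%:R) + 1 + m%:R = - (y' + l%:R - 1).
  by rewrite natrD; ring.
have -> : x - y - (x + y' + (m + l)%:R) + 1 = - (y + y' + (m + l)%:R - 1) by ring.
rewrite !poch_opp.
have -> : y' + l%:R - 1 - l%:R + 1 = y' by ring.
have -> : y + y' + (m + l)%:R - 1 - (m + l)%:R + 1 = y + y' by ring.
rewrite !addnA (pochD _ (m + l) r) (pochD _ l r) (pochD z).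
have shift := @vwp_factor_shift R (x + y') m l r xy_nz.
have nX : pochhammer (x + y' + (2 * m)%:R + 1 + l%:R) (l + r) != 0.
  apply: poch_neq0 => i _.
  by rewrite (addrAC (x + y')) -!addrA -!natrD !addrA.
have -> : vwp_factor (x + y' + (2 * m)%:R) l =
    vwp_factor (x + y') (m + l) * pochhammer (x + y' + (m + l)%:R) m /
    pochhammer (x + y' + 1 + (m + l)%:R) (m + l + r) *
    pochhammer (x + y' + (2 * m)%:R + 1 + l%:R) (l + r).
  by rewrite -shift divfK.
have fm := fact_nz m; have fl := fact_nz l; have fr := fact_nz r.
have fml := fact_nz (m + l)%N; have flr := fact_nz (l + r)%N.
have n1 : pochhammer (x - z + 1 + m%:R) (l + r) != 0.
  by apply: poch_neq0 => i lti; rewrite -addrA -natrD xz_nz.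
have n2 : pochhammer (x - y - z + 1) (m + l + r) != 0 by exact: poch_neq0.
have n3 : pochhammer (y + y') (m + l) != 0 by exact: poch_neq0.
have n4 : pochhammer (x + 1 + m%:R) (m + l) != 0.
  by apply: poch_neq0 => i _; rewrite -addrA -natrD.
have n5 : pochhammer (x + 1 + m%:R + (m + l)%:R) r != 0.
  by apply: poch_neq0 => i _; rewrite -!addrA -!natrD addrA.
have n6 : pochhammer (x + y' + 1 + (m + l)%:R) (m + l + r) != 0.
  by apply: poch_neq0 => i _; rewrite -addrA -natrD.
have sgn_nz (n : nat) : (-1) ^+ n != 0 :> R by rewrite signr_eq0.
have sm := sgn_nz m; have sl := sgn_nz l.
rewrite exprD.
by field; rewrite n1 n2 n3 n4 n5 n6 nX sm sl fm fl fr fml flr.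
Qed.

(** * Signs *)

Definition dougall_positive (R : realType) (x y z : R) N :=
  (forall i, (i < N)%N ->
     [/\ z + i%:R < 0, 0 < x - z + 1 + i%:R & 0 < x - y - z + 1 + i%:R]) \/
  (forall i, (i < N)%N ->
     [/\ 0 < z + i%:R, x - z + 1 + i%:R < 0 & x - y - z + 1 + i%:R < 0]).

(** In the first case the sign [(-1)^k] is absorbed by [(z)_k]; in the second by
    the quotient of [(x-z+1+k)_r] and [(x-y-z+1)_{k+r}]. *)
Lemma dougall_term_ge0 (R : realType) (x y z : R) k r :
  0 < x + 1 -> 0 < y -> 0 < x - y + 1 -> dougall_positive x y z (k + r) ->
  0 <= dougall_term x y z k r.
Proof.
move=> x1_gt0 y_gt0 xy_gt0 xyz_sign.
have gt0D (w : R) (i : nat) : 0 < w -> 0 < w + i%:R by move/ltr_wpDr; apply.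
have main : 0 <= (-1) ^+ k * (pochhammer z k * pochhammer (x - z + 1 + k%:R) r /
                              pochhammer (x - y - z + 1) (k + r)).
  case: xyz_sign => sgn.
    rewrite !mulrA; apply: divr_ge0; first apply: mulr_ge0; apply: ltW.
    - apply: poch_lt0_sign.
      by move=> i ltik; case: (sgn i); first by rewrite ltn_addr.
    - apply: poch_gt0 => i ltir; rewrite -addrA -natrD.
      by case: (sgn (k + i)%N); first by rewrite ltn_add2l.
    - by apply: poch_gt0 => i lti; case: (sgn i).
  have -> : (-1) ^+ k * (pochhammer z k * pochhammer (x - z + 1 + k%:R) r /
              pochhammer (x - y - z + 1) (k + r)) =
      pochhammer z k * ((-1) ^+ r * pochhammer (x - z + 1 + k%:R) r) /
      ((-1) ^+ (k + r) * pochhammer (x - y - z + 1) (k + r)).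
    rewrite invfM -signr_odd invr_sign signr_odd exprD.
    have := sqrr_sign R r; rewrite expr2 => sgn_sq.
    transitivity (((-1) ^+ r * (-1) ^+ r) * ((-1) ^+ k * (pochhammer z k *
      pochhammer (x - z + 1 + k%:R) r / pochhammer (x - y - z + 1) (k + r)))).
      by rewrite sgn_sq mul1r.
    ring.
  apply: divr_ge0; first apply: mulr_ge0; apply: ltW.
  - by apply: poch_gt0 => i ltik; case: (sgn i); first by rewrite ltn_addr.
  - apply: poch_lt0_sign => i ltir; rewrite -addrA -natrD.
    by case: (sgn (k + i)%N); first by rewrite ltn_add2l.
  - by apply: poch_lt0_sign => i lti; case: (sgn i).
have w_ge0 : 0 <= vwp_factor x k.
  case: k {xyz_sign main} => [|k]; first by rewrite ler01.
  have xk : 0 < x + k.+1%:R by rewrite -nat1r addrA gt0D.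
  rewrite vwp_factorE ?gt_eqF // divr_ge0 ?(ltW xk) //.
  by rewrite mul2n -addnn natrD addrA ltW // gt0D.
have -> : dougall_term x y z k r =
    ((k + r)`!%:R / (k`!%:R * r`!%:R)) * vwp_factor x k *
    (pochhammer y k * pochhammer (x - y + 1 + k%:R) r /
     pochhammer (x + 1 + k%:R) (k + r)) *
    ((-1) ^+ k * (pochhammer z k * pochhammer (x - z + 1 + k%:R) r /
                  pochhammer (x - y - z + 1) (k + r))).
  by rewrite /dougall_term !invfM; ring.
apply: mulr_ge0 main; apply: mulr_ge0; first by rewrite mulr_ge0 // divr_ge0 ?mulr_ge0 ?ler0n.
rewrite divr_ge0 ?mulr_ge0 // ltW // poch_gt0 // => i _; by rewrite ?gt0D.
Qed.

(** * The transition probabilities *)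

(** Guarantees that no denominator in the transition probabilities vanishes.
    Unlike [time_set], this condition is also available for the parameters of
    the bridge. *)
Definition regular_time (R : realType) N (A C t : R) :=
  0 < 2 * A + t + 1 /\ forall i, (i < N)%N -> A - C + t + 1 + i%:R != 0.

Lemma trans_probE (R : realType) (A C s t : R) j m r :
  regular_time (j + m + r) A C s -> regular_time (j + m + r) A C t ->
  trans_prob (j + m + r) A C s t j (j + m) =
  dougall_term (2 * A + t + (2 * j)%:R) (t - s) (A + C + j%:R) m r.
Proof.
move=> [s_gt0 s_nz] [t_gt0 t_nz].
rewrite /trans_prob leq_addr addKn -addnA addKn p_weightE.
- by congr (dougall_term _ _ _ _ _); rewrite ?natrM; field.
- move=> i _; rewrite gt_eqF //.
  have -> : A + t / 2 + j%:R - (- A - s + t / 2 - j%:R) + 1 + i%:R =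
            2 * A + s + 1 + (2 * j + i)%:R by rewrite natrD natrM; ring.
  by rewrite ltr_wpDr.
- move=> i ltim.
  have -> : A + t / 2 + j%:R - (C - t / 2) + 1 + i%:R =
            A - C + t + 1 + (j + i)%:R by rewrite natrD; field.
  by apply: t_nz; lia.
- move=> i; rewrite gt_eqF //.
  have -> : 2 * (A + t / 2 + j%:R) + 1 + i%:R =
            2 * A + t + 1 + (2 * j + i)%:R by rewrite natrD natrM; field.
  by rewrite ltr_wpDr.
- move=> i ltim.
  have -> : - (- A - s + t / 2 - j%:R) - (C - t / 2) + 1 + i%:R =
            A - C + s + 1 + (j + i)%:R by rewrite natrD; ring.
  by apply: s_nz; lia.
Qed.

Lemma trans_prob_sum (R : realType) N (A C s t : R) j :
  regular_time N A C s -> regular_time N A C t -> (j <= N)%N ->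
  \sum_(j <= k < N.+1) trans_prob N A C s t j k = 1.
Proof.
move=> s_reg t_reg lejN.
rewrite -{1}[j]add0n big_addn subSn //.
have [[_ s_nz] [t_gt0 _]] := (s_reg, t_reg).
rewrite -(@dougall_sum R (2 * A + t + (2 * j)%:R) (t - s) (A + C + j%:R) (N - j)).
- apply: eq_big_nat => m; rewrite ltnS => /andP[_ lem].
  have eN : N = (j + m + (N - j - m))%N by lia.
  by rewrite addnC {1}eN trans_probE -?eN.
- move=> i.
  have -> : 2 * A + t + (2 * j)%:R + 1 + i%:R = 2 * A + t + 1 + (2 * j + i)%:R.
    by rewrite natrD; ring.
  by rewrite gt_eqF // ltr_wpDr.
- move=> i lti.
  have -> : 2 * A + t + (2 * j)%:R - (t - s) - (A + C + j%:R) + 1 + i%:R =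
            A - C + s + 1 + (j + i)%:R by rewrite natrD natrM; ring.
  by apply: s_nz; lia.
Qed.

(** The bridge has parameters [A - C + s + 1 + i = (s - u) + (i + 1 - n)], negative
    for all times before [u]. *)
Lemma regular_time_bridge (R : realType) n (A s u : R) :
  0 < 2 * A + s + 1 -> s < u -> regular_time n A (A + u + n%:R) s.
Proof.
move=> s_gt0 ltsu; split=> // i ltin; rewrite lt_eqF //.
have : i.+1%:R <= n%:R :> R by rewrite ler_nat.
by rewrite -natr1; lra.
Qed.

(** The bridge of the chain is a chain of the same family, with top state [n]
    and with [A + u + n] in place of [C]. *)
Lemma trans_prob_chain (R : realType) N (A C s t u : R) j k n :
  regular_time N A C s -> regular_time N A C t -> regular_time N A C u ->
  s < t -> t < u -> (j <= k)%N -> (k <= n)%N -> (n <= N)%N ->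
  trans_prob N A C s t j k * trans_prob N A C t u k n =
  trans_prob N A C s u j n * trans_prob n A (A + u + n%:R) s t j k.
Proof.
move=> s_reg t_reg u_reg ltst ltut lejk lekn lenN.
have [m ek] : exists m, k = (j + m)%N by exists (k - j)%N; lia.
have [l en] : exists l, n = (j + m + l)%N by exists (n - k)%N; lia.
have [r eN] : exists r, N = (j + m + l + r)%N by exists (N - n)%N; lia.
subst k n N => {lejk lekn lenN}.
have [[s_gt0 s_nz] [t_gt0 t_nz] [u_gt0 _]] := And3 s_reg t_reg u_reg.
rewrite (@trans_probE R A (A + u + (j + m + l)%:R)); last first.
- exact: regular_time_bridge.
- by apply: regular_time_bridge => //; exact: lt_trans ltut.
rewrite (@trans_probE _ A C t u (j + m) l r) //.
rewrite -!(addnA (j + m)) trans_probE ?addnA // -(addnA j m l) trans_probE ?addnA //.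
have := @dougall_term_chain R (2 * A + t + (2 * j)%:R) (t - s) (u - t) (A + C + j%:R) m l r.
have -> : 2 * A + t + (2 * j)%:R + (u - t) + (2 * m)%:R = 2 * A + u + (2 * (j + m))%:R.
  by rewrite mulnDr natrD; ring.
have -> : A + C + j%:R + m%:R = A + C + (j + m)%:R by rewrite natrD; ring.
have -> : 2 * A + t + (2 * j)%:R + (u - t) = 2 * A + u + (2 * j)%:R by ring.
have -> : t - s + (u - t) = u - s by ring.
have -> : 2 * A + u + (2 * j)%:R + (m + l)%:R = A + (A + u + (j + (m + l))%:R) + j%:R.
  by rewrite natrD natrM; ring.
rewrite (addnA j m l); apply.
- move=> i; rewrite gt_eqF //.
  have -> : 2 * A + t + (2 * j)%:R + 1 + i%:R = 2 * A + t + 1 + (2 * j + i)%:R.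
    by rewrite natrD; ring.
  by rewrite ltr_wpDr.
- move=> i; rewrite gt_eqF //.
  have -> : 2 * A + u + (2 * j)%:R + 1 + i%:R = 2 * A + u + 1 + (2 * j + i)%:R.
    by rewrite natrD; ring.
  by rewrite ltr_wpDr.
- move=> i lti.
  have -> : 2 * A + t + (2 * j)%:R - (A + C + j%:R) + 1 + (m + i)%:R =
            A - C + t + 1 + (j + m + i)%:R by rewrite !natrD ?natrM; ring.
  by apply: t_nz; lia.
- move=> i lti.
  have -> : 2 * A + t + (2 * j)%:R - (t - s) - (A + C + j%:R) + 1 + i%:R =
            A - C + s + 1 + (j + i)%:R by rewrite natrD natrM; ring.
  by apply: s_nz; lia.
- by move=> i _; rewrite gt_eqF // ltr_wpDr // subr_gt0 (lt_trans ltst).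
Qed.

Lemma trans_prob_ge0 (R : realType) N (A C s t : R) j k :
  0 < 2 * A + s + 1 -> s < t ->
  (forall i, (i < N)%N ->
     [/\ A + C + i%:R < 0, 0 < A - C + t + 1 + i%:R &
         0 < A - C + s + 1 + i%:R]) \/
  (forall i, (i < N)%N ->
     [/\ 0 < A + C + i%:R, A - C + t + 1 + i%:R < 0 &
         A - C + s + 1 + i%:R < 0]) ->
  (k <= N)%N -> 0 <= trans_prob N A C s t j k.
Proof.
move=> s_gt0 ltst sgn lekN.
have [lejk | ltkj] := leqP j k; last by rewrite /trans_prob leqNgt ltkj lexx.
have [m ek] : exists m, k = (j + m)%N by exists (k - j)%N; lia.
have [r eN] : exists r, N = (j + m + r)%N by exists (N - k)%N; lia.
subst k N.
have t_gt0 : 0 < 2 * A + t + 1 by lra.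
rewrite trans_probE.
- have gt0D (w : R) (i : nat) : 0 < w -> 0 < w + i%:R by move/ltr_wpDr; apply.
  apply: dougall_term_ge0; rewrite ?subr_gt0 //.
  + by rewrite addrAC gt0D.
  + have -> : 2 * A + t + (2 * j)%:R - (t - s) + 1 = 2 * A + s + 1 + (2 * j)%:R by ring.
    exact: gt0D.
  + have e1 (i : nat) : A + C + j%:R + i%:R = A + C + (j + i)%:R.
      by rewrite natrD addrA.
    have e2 (i : nat) : 2 * A + t + (2 * j)%:R - (A + C + j%:R) + 1 + i%:R =
                        A - C + t + 1 + (j + i)%:R by rewrite natrD natrM; ring.
    have e3 (i : nat) : 2 * A + t + (2 * j)%:R - (t - s) - (A + C + j%:R) + 1 + i%:R =
                        A - C + s + 1 + (j + i)%:R by rewrite natrD natrM; ring.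
    by case: sgn => sgn; [left | right] => i lti; rewrite e1 e2 e3; apply: sgn; lia.
- by split=> // i lti; case: sgn => /(_ i lti)[_ _ h]; rewrite ?(gt_eqF h) ?(lt_eqF h).
- by split=> // i lti; case: sgn => /(_ i lti)[_ h _]; rewrite ?(gt_eqF h) ?(lt_eqF h).
Qed.

Theorem proposition2p3 (R : realType) (N : nat) (A B C : R)
    (hN : (1 <= N)%N)
    (hA : - (1 / 2) < A)
    (hB : - A < B /\ B < A + 1)
    (hC : C < - A - N%:R + 1 \/ A + N%:R < C) :
  forall s t u : R,
    s \in time_set N A B C -> t \in time_set N A B C ->
    u \in time_set N A B C -> s < t -> t < u ->
    [/\ (forall k n : nat, (k <= N)%N -> (n <= N)%N ->
           0 <= trans_prob N A C s t k n),
        (forall j n : nat, (j <= n)%N -> (n <= N)%N ->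
           trans_prob N A C s u j n =
           \sum_(j <= k < n.+1)
              trans_prob N A C s t j k * trans_prob N A C t u k n)
      & (forall j : nat, (j <= N)%N ->
           \sum_(j <= k < N.+1) trans_prob N A C s t j k = 1)].
Proof.
move=> s t u sT tT uT ltst ltut.
have [hB1 hB2] := hB.
have N_ge1 : 1 <= N%:R :> R by rewrite ler1n.
have iN (i : nat) : (i < N)%N -> 0 <= i%:R :> R /\ i%:R + 1 <= N%:R :> R.
  by move=> ltiN; rewrite ler0n natr1 ler_nat.
have time_gt0 x : x \in time_set N A B C -> 0 < 2 * A + x + 1.
  by rewrite /time_set; case: ifP => _; rewrite in_itv /= ?andbT => h; lra.
have time_sign :
     ((forall i, (i < N)%N -> A + C + i%:R < 0) /\
       (forall x i, x \in time_set N A B C -> (i < N)%N -> 0 < A - C + x + 1 + i%:R)) \/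
     ((forall i, (i < N)%N -> 0 < A + C + i%:R) /\
       (forall x i, x \in time_set N A B C -> (i < N)%N -> A - C + x + 1 + i%:R < 0)).
  have [ltC | leC] := ltP C (- A - N%:R + 1); [left | right].
    split=> [i /iN[] | x i xT /iN[i0 i1]]; first by lra.
    by have := time_gt0 x xT; lra.
  have {hC} hC : A + N%:R < C by case: hC => // hC; lra.
  split=> [i /iN[] | x i]; first by lra.
  by rewrite /time_set ltNge leC /= in_itv /= => /andP[_ ?] /iN[i0 i1]; lra.
have reg x : x \in time_set N A B C -> regular_time N A C x.
  move=> xT; split; first exact: time_gt0.
  by move=> i ltiN; case: time_sign => -[_ h];
     rewrite ?(gt_eqF (h _ _ xT ltiN)) ?(lt_eqF (h _ _ xT ltiN)).
have [sR tR uR] := And3 (reg s sT) (reg t tT) (reg u uT).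
split=> [k n _ lenN | j n lejn lenN | j lejN]; last exact: trans_prob_sum.
- apply: trans_prob_ge0; rewrite ?time_gt0 //.
  by case: time_sign => -[h1 h2]; [left | right] => i lti;
     rewrite h1 ?h2.
rewrite (eq_big_nat _ _ (F2 := fun k =>
    trans_prob N A C s u j n * trans_prob n A (A + u + n%:R) s t j k)).
  rewrite -mulr_sumr trans_prob_sum ?mulr1 //; apply: regular_time_bridge.
  - exact: time_gt0.
  - exact: lt_trans ltut.
  - exact: time_gt0.
  - exact: ltut.
by move=> k /andP[lejk ltkn]; exact: trans_prob_chain.
Qed.
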